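(* Let $G$ and $G'$ be finite connected multigraphs. If the simplicial complexes $\mathfrak{M}(G)$ and $\mathfrak{M}(G')$ (the complexes of discrete Morse functions of $G$ and of $G'$) are isomorphic, then $G$ and $G'$ are isomorphic multigraphs.
   Context: A multigraph $G$ is a triple $(V_G,E_G,f_G)$ with $V_G$ a finite set of vertices, $E_G$ a finite set of edges, and $f_G:E_G\to\{\{u,v\}:u,v\in V_G,\ u\ne v\}$ a map assigning to each edge its two boundary vertices. So there are no loops, but parallel edges (distinct edges with the same image under $f_G$) are allowed. Connected multigraphs are nonempty. An isomorphism $G\to G'$ is a pair of bijections $V_G\to V_{G'}$, $E_G\to E_{G'}$ compatible with the boundary maps. Regard $G$ as a $1$-dimensional regular CW-complex whose cells are the elements of $V_G\cup E_G$; write $v\prec e$ if $v\in f_G(e)$. A discrete Morse function on $G$ is a map $h:V_G\cup E_G\to\mathbb{R}$ such that for every cell $\sigma$: $|\{\tau\succ\sigma: h(\tau)\le h(\sigma)\}|\le 1$ and $|\{\nu\prec\sigma: h(\nu)\ge h(\sigma)\}|\le 1$. Its regular pairs are the pairs $(v,e)$ with $v\prec e$ and $h(v)\ge h(e)$. Functions with the same regular pairs are not distinguished. A primitive Morse function is one with exactly one regular pair, and it is identified with that pair $(v,e)$. $\mathfrak{M}(G)$ is the simplicial complex whose vertices are the primitive Morse functions on $G$, i.e. the pairs $(v,e)$ with $v\prec e$, and whose simplices are the nonempty sets of such pairs that are exactly the set of regular pairs of some discrete Morse function on $G$. Equivalently, regarding $(v,e)$ as the edge $e$ directed away from $v$,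 a nonempty set of directed edges is a simplex iff no edge of $G$ is used in both directions, no vertex is the source of two of the directed edges, and the directed edges contain no directed cycle. *)

(* Defs.v *)
From HB Require Import structures.
From mathcomp Require Import all_boot all_order all_algebra.
From mathcomp Require Import reals.

Set Implicit Arguments.
Unset Strict Implicit.
Unset Printing Implicit Defensive.

Import Order.TTheory GRing.Theory Num.Theory.
Local Open Scope ring_scope.

(* Two-element boundary sets: no loops, but [bd] need not be injective, so
   parallel edges are allowed. *)
Record multigraph := Multigraph {
  vertex : finType;
  edge : finType;
  bd : edge -> {set vertex};
  card_bd : forall e, #|bd e| = 2%N
}.

Definition adjacent (G : multigraph) : rel (vertex G) :=
  fun u v => [exists e : edge G, bd e == [set u; v]].

Definition mg_connected (G : multigraph) : Prop :=
  (0 < #|vertex G|)%N /\ forall u v : vertex G, connect (@adjacent G) u v.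

Definition mg_isomorphic (G G' : multigraph) : Prop :=
  exists (fV : vertex G -> vertex G') (fE : edge G -> edge G'),
    [/\ bijective fV, bijective fE & forall e, bd (fE e) = fV @: bd e].

(* Finite abstract simplicial complexes, with simplices nonempty and every
   element of the vertex type an actual vertex. *)
Record simplicial_complex := SimplicialComplex {
  sc_vertex : finType;
  simplex : {set sc_vertex} -> Prop;
  simplex_nonempty : forall S, simplex S -> S != set0;
  simplex_vertex : forall x, simplex [set x];
  simplex_face : forall S T : {set sc_vertex},
      simplex S -> T \subset S -> T != set0 -> simplex T
}.

Definition sc_isomorphic (K K' : simplicial_complex) : Prop :=
  exists2 f : sc_vertex K -> sc_vertex K', bijective f
    & forall S : {set sc_vertex K}, simplex S <-> simplex (f @: S).

Definition cell (G : multigraph) : finType := (vertex G + edge G)%type.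

Definition prec (G : multigraph) (s t : cell G) : bool :=
  match s, t with
  | inl v, inr e => v \in bd e
  | _, _ => false
  end.

Definition discrete_morse (R : realType) (G : multigraph) (h : cell G -> R)
    : Prop :=
  forall s : cell G,
    (#|[set t | prec s t & (h t <= h s)%R]| <= 1)%N /\
    (#|[set n | prec n s & (h s <= h n)%R]| <= 1)%N.

(* The pairs (v, e) with v a boundary vertex of e; each of them stands for the
   class of primitive Morse functions having it as only regular pair. *)
Definition primitive (G : multigraph) : finType :=
  {p : vertex G * edge G | p.1 \in bd p.2}.

Definition regular_pairs (R : realType) (G : multigraph) (h : cell G -> R)
    : {set primitive G} :=
  [set p | h (inr (val p).2) <= h (inl (val p).1)].

Definition morse_simplex (R : realType) (G : multigraph)
    (S : {set primitive G}) : Prop :=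
  S != set0 /\
  exists2 h : cell G -> R, discrete_morse h & regular_pairs h = S.

Section MorseComplex.
Variables (R : realType) (G : multigraph).

Lemma morse_simplex_nonempty S : @morse_simplex R G S -> S != set0.
Proof. by case. Qed.

Lemma morse_simplex_vertex x : @morse_simplex R G [set x].
Proof.
split; first by apply/set0Pn; exists x; rewrite inE.
pose h (c : cell G) : R := match c with
  | inl v => (v == (val x).1)%:R
  | inr e => if e == (val x).2 then 1 else 2%:R end.
have leh v e : (h (inr e) <= h (inl v)) = ((v, e) == val x).
  rewrite /h; case: (val x) => a b; rewrite xpair_eqE /=; case: (v == _); case: (e == _);
  by rewrite /= ?ler_nat ?lexx // ler10.
exists h; last by apply/setP=> p; rewrite !inE leh -surjective_pairing.
case=> [v|e]; split; rewrite leqNgt; apply/negP => /card_gt1P[[a|a] [[b|b] []]];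
  rewrite !inE //= !leh => /andP[_ /eqP Ha] /andP[_ /eqP Hb] /eqP; apply;
  by move: Ha; rewrite -Hb => -[->].
Qed.

Lemma morse_simplex_face (S T : {set primitive G}) :
  @morse_simplex R G S -> T \subset S -> T != set0 -> @morse_simplex R G T.
Proof.
case=> _ [h hM hS] sTS T0; split=> //.
pose used e := [exists p in T, (val p).2 == e].
pose M := 1 + \sum_(v : vertex G) `|h (inl v)|.
have ltM v : h (inl v) < M.
  rewrite /M (bigD1 v) //=; apply: (le_lt_trans (ler_norm _)).
  rewrite addrCA ltrDl; apply: (lt_le_trans ltr01); rewrite lerDl.
  by apply: sumr_ge0.
pose k (c : cell G) : R := match c with
  | inl v => h c | inr e => if used e then h c else M end.
have lek v e : (k (inr e) <= k (inl v)) = used e && (h (inr e) <= h (inl v)).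
  by rewrite /k; case: ifP => //= _; apply/negbTE; rewrite -ltNge.
exists k.
  move=> s; have [h1 h2] := hM s; split.
    apply: leq_trans h1; apply/subset_leq_card/subsetP => t; rewrite !inE.
    by case: s t {h2} => [v|e] [w|f] //=; rewrite lek => /and3P[-> _ ->].
  apply: leq_trans h2; apply/subset_leq_card/subsetP => t; rewrite !inE.
  by case: s t {h1} => [v|e] [w|f] //=; rewrite lek => /and3P[-> _ ->].
apply/setP=> p; rewrite inE lek; apply/andP/idP => [[]|pT].
  case/existsP=> q /andP[qT /eqP qp] le_p.
  have := subsetP sTS q qT; rewrite -hS inE qp => le_q.
  suff -> : p = q by [].
  apply: val_inj; rewrite [val p]surjective_pairing [val q]surjective_pairing.
  rewrite qp; congr (_, _).
  have [_ /card_le1_eqP h2] := hM (inr (val p).2).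
  suff [] : (inl (val p).1 : cell G) = inl (val q).1 by [].
  apply: h2; rewrite inE; apply/andP; split.
  - by rewrite -qp; apply: (valP q).
  - exact: le_q.
  - exact: (valP p).
  - exact: le_p.
split; first by apply/existsP; exists p; rewrite pT eqxx.
by have := subsetP sTS p pT; rewrite -hS inE.
Qed.

Definition morse_complex : simplicial_complex :=
  SimplicialComplex morse_simplex_nonempty morse_simplex_vertex
    morse_simplex_face.

End MorseComplex.

(* Main.v *)
Require Import Defs.
From HB Require Import structures.
From mathcomp Require Import all_boot all_order all_algebra.
From mathcomp Require Import reals.

(** The 1-skeleton of the Morse complex already determines [G]. Two distinct
    pairs fail to span a 1-simplex iff they [clash]: same source, or opposite
    directions of the same or of parallel edges. If [G] has at least three
    vertices, two pairs have the same clash-neighbourhood iff they have the same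
    source and target, so an isomorphism [f] preserves these [dart] classes and
    their sizes, the edge multiplicities. If [f] respects reversal of direction
    it respects sources and induces the bijection on vertices. If it fails to at
    one pair [p], then the source of [p] has exactly two neighbours and the
    failure spreads to the two pairs adjacent to [p], so by connectedness both
    multigraphs are cycles with constant multiplicity, and [f] exchanges
    "reverse" with "other pair with the same source". A coherent orientation [Z]
    of the cycle, being a transversal of both pairings, is then sent to a
    coherent orientation of the other cycle, which yields the isomorphism. With
    at most two vertices the number of edges decides. *)

Set Implicit Arguments.
Unset Strict Implicit.
Unset Printing Implicit Defensive.

Import Order.TTheory GRing.Theory Num.Theory.

(** * Maps over a common base, and transversals of two involutions *)

Lemma fibre_inj (A B : finType) (S : eqType) (f : A -> S) (g : B -> S) :
  (forall s, #|[pred a | f a == s]| <= #|[pred b | g b == s]|) ->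
  exists2 h : A -> B, injective h & forall a, g (h a) = f a.
Proof.
move=> le_fg.
have fa a : a \in enum [pred x | f x == f a] by rewrite mem_enum inE.
have lt_idx a :
    index a (enum [pred x | f x == f a]) < size (enum [pred b | g b == f a]).
  by rewrite -cardE; apply: leq_trans (le_fg _); rewrite cardE index_mem.
have [b0 _|B0] := pickP (@predT B); last first.
  have A0 (a : A) : False.
    have := leq_ltn_trans (leq0n _) (lt_idx a); rewrite -cardE.
    by case/card_gt0P => b; have := B0 b.
  by exists (fun a => match A0 a with end) => a; case: (A0 a).
(* Two fibres over the same point are matched by position in their enumerations; by [lt_idx] the
   default [b0] is never returned. *)
pose h a := nth b0 (enum [pred b | g b == f a])
                   (index a (enum [pred x | f x == f a])).
have gh a : g (h a) = f a.
  by have := mem_nth b0 (lt_idx a); rewrite mem_enum inE => /eqP.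
exists h => // a a' eq_h.
have eq_f : f a = f a' by rewrite -!gh eq_h.
have lt_idx' := lt_idx a'; move: eq_h; rewrite /h -eq_f in lt_idx' *.
move/eqP; rewrite nth_uniq ?enum_uniq ?lt_idx //; move/eqP=> eq_idx.
have := nth_index a (fa a); rewrite eq_idx nth_index // eq_f; exact: fa.
Qed.

Lemma fibre_bij (A B : finType) (S : eqType) (f : A -> S) (g : B -> S) :
  (forall s, #|[pred a | f a == s]| = #|[pred b | g b == s]|) ->
  exists2 h : A -> B, bijective h & forall a, g (h a) = f a.
Proof.
move=> eq_fg.
have [|h h_inj gh] := @fibre_inj _ _ _ f g; first by move=> s; rewrite eq_fg.
have [|k k_inj _] := @fibre_inj _ _ _ g f; first by move=> s; rewrite eq_fg.
by exists h => //; apply: inj_card_bij h_inj (leq_card k k_inj).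
Qed.

(* Two involutions moving every class of [w] have a common transversal: the
   orbits of [b \o a], saturated by [w], come in pairs exchanged by both
   involutions, and [Z] takes one orbit of each pair. *)
Lemma involution_transversal (T : finType) (D : eqType) (w : T -> D)
    (a b : T -> T) (aK : involutive a) (bK : involutive b)
    (wa : forall x y, w x = w y -> w (a x) = w (a y))
    (wb : forall x y, w x = w y -> w (b x) = w (b y))
    (aN : forall x, w (a x) <> w x) (bN : forall x, w (b x) <> w x) :
  exists Z : {set T},
    [/\ forall x y, w x = w y -> (x \in Z) = (y \in Z),
        forall x, (a x \in Z) = (x \notin Z)
      & forall x, (b x \in Z) = (x \notin Z)].
Proof.
pose f x := b (a x).
have f_inj : injective f by apply: inj_comp; apply: can_inj.
have wf k x y : w x = w y -> w (iter k f x) = w (iter k f y).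
  by move=> wxy; elim: k => //= k IHk; apply/wb/wa.
(* If [k.+2] iterations at [x] reach the class of [a x], applying [b] and then [a] shows that [k]
   iterations at [f x] reach the class of [a (f x)]; [aN] and [bN] exclude the base cases 0 and
   1. *)
have iterN k x : w (iter k f x) <> w (a x).
  elim/ltn_ind: k x => -[|[|k]] IHk x.
  - by move=> /esym/aN.
  - by move=> /bN.
  move=> eq_w; apply: (IHk k (ltnW (ltnSn _)) (f x)).
  rewrite -iterSr; move: eq_w => /= /wb; rewrite bK => /wa.
  by rewrite aK.
pose orb x := [set y | [exists z, fconnect f x z && (w z == w y)]].
have orb_f x : orb (f x) = orb x.
  apply/setP=> y; rewrite !inE; apply: eq_existsb => z.
  by rewrite -(same_fconnect1 f_inj x).
have orb_w x y : w x = w y -> orb x = orb y.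
  suff sub u v : w u = w v -> orb u \subset orb v.
    by move=> wxy; apply/eqP; rewrite eqEsubset !sub.
  move=> wuv; apply/subsetP=> t; rewrite !inE => /existsP[z /andP[]].
  move=> /iter_findex <- /eqP <-; apply/existsP.
  exists (iter (findex f u z) f v).
  by rewrite fconnect_iter (wf _ _ _ wuv) eqxx.
have orb_a x : orb x != orb (a x).
  have: a x \in orb (a x).
    by rewrite inE; apply/existsP; exists (a x); rewrite connect0 eqxx.
  apply: contraTneq => <-; rewrite inE.
  by apply/existsP => -[z /andP[/iter_findex <- /eqP /iterN]].
have orb_b x : orb (b x) = orb (a x).
  by rewrite -(orb_f (a x)) /f aK.
have orb_ab x : orb (a (b x)) = orb x.
  by rewrite -(orb_f (a (b x))) /f aK bK.
(* Ranking the orbits decides between the two of a pair: the one of smaller rank goes into the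
   transversal. *)
pose r x : nat := enum_rank (orb x).
have r_a x : r x != r (a x).
  by apply: contraNneq (orb_a x) => /val_inj/enum_rank_inj ->.
exists [set x | r x < r (a x)]; split=> [x y wxy|x|x]; rewrite !inE.
- by rewrite /r (orb_w _ _ wxy) (orb_w _ _ (wa _ _ wxy)).
- by rewrite aK -leqNgt ltn_neqAle eq_sym r_a.
- rewrite /r orb_b orb_ab -/(r _) -/(r _) -leqNgt.
  by rewrite ltn_neqAle eq_sym r_a.
Qed.

(** * Directed edges and the clash relation *)

Section Darts.
Variable G : multigraph.
Implicit Types (p q : primitive G) (u v : vertex G).

Definition src p : vertex G := (val p).1.
Definition edg p : edge G := (val p).2.

Lemma tgt_exists p : exists v, (v != src p) && (bd (edg p) == [set src p; v]).
Proof.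
have /eqP/cards2P[x [y [neq_xy eq_bd]]] := card_bd (edg p).
have: src p \in bd (edg p) by exact: (valP p).
rewrite eq_bd !inE => /orP[]/eqP ->; [exists y | exists x].
  by rewrite eq_sym neq_xy eqxx.
by rewrite neq_xy setUC eqxx.
Qed.

Definition tgt p : vertex G := xchoose (tgt_exists p).

Lemma tgt_neq_src p : tgt p != src p.
Proof. by case/andP: (xchooseP (tgt_exists p)). Qed.

Lemma bd_edg p : bd (edg p) = [set src p; tgt p].
Proof. by case/andP: (xchooseP (tgt_exists p)) => _ /eqP. Qed.

(** A directed edge up to parallelism; its fibres have the edge multiplicities as sizes. *)
Definition dart p : vertex G * vertex G := (src p, tgt p).

Lemma flip_subproof p : ((tgt p, edg p) : vertex G * edge G).1 \in bd (edg p).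
Proof. by rewrite bd_edg set22. Qed.

Definition flip p : primitive G := Sub (tgt p, edg p) (flip_subproof p).

Lemma src_flip p : src (flip p) = tgt p. Proof. by []. Qed.

Lemma edg_flip p : edg (flip p) = edg p. Proof. by []. Qed.

Lemma eq_primitive p q : src p = src q -> edg p = edg q -> p = q.
Proof.
move=> eq_s eq_e; apply: val_inj; rewrite [val p]surjective_pairing.
by rewrite [val q]surjective_pairing; congr (_, _).
Qed.

Lemma tgtE p v : v \in bd (edg p) -> v != src p -> tgt p = v.
Proof. by rewrite bd_edg !inE => /orP[]/eqP -> //; rewrite eqxx. Qed.

Lemma tgt_flip p : tgt (flip p) = src p.
Proof.
by apply: tgtE; rewrite ?edg_flip ?bd_edg ?set21 // src_flip eq_sym tgt_neq_src.
Qed.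

Lemma flipK : involutive flip.
Proof. by move=> p; apply: eq_primitive; rewrite ?src_flip ?tgt_flip. Qed.

Lemma dart_flip p : dart (flip p) = (tgt p, src p).
Proof. by rewrite /dart tgt_flip. Qed.

Lemma dart_flipP p q : dart p = dart q -> dart (flip p) = dart (flip q).
Proof. by rewrite !dart_flip => -[-> ->]. Qed.

Lemma dart_bd p u v : u != v ->
  (dart p == (u, v)) = (src p == u) && (bd (edg p) == [set u; v]).
Proof.
move=> neq_uv; rewrite xpair_eqE; case: eqP => //= eq_s.
apply/eqP/eqP => [<-|eq_bd]; first by rewrite bd_edg eq_s.
by apply: tgtE; rewrite ?eq_s 1?eq_sym // eq_bd set22.
Qed.

Lemma primitive_of_bd e u v : bd e = [set u; v] -> u != v ->
  exists2 p, edg p = e & dart p = (u, v).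
Proof.
move=> eq_bd neq_uv.
have ue : ((u, e) : vertex G * edge G).1 \in bd e by rewrite eq_bd set21.
exists (Sub (u, e) ue) => //; apply/eqP.
by rewrite dart_bd // eqxx /=; apply/eqP.
Qed.

Lemma bd_neq e u v : bd e = [set u; v] -> u != v.
Proof.
by move=> eq_bd; have := card_bd e; rewrite eq_bd cards2; case: eqP.
Qed.

Lemma card_dart u v : u != v ->
  #|[pred p | dart p == (u, v)]| = #|[pred e | bd e == [set u; v]]|.
Proof.
move=> neq_uv; rewrite -(card_in_image (f := edg)); last first.
  move=> p q; rewrite !inE => /eqP[sp _] /eqP[sq _].
  by apply: eq_primitive; rewrite sp sq.
apply: eq_card => e; rewrite inE; apply/imageP/eqP => [[p]|eq_bd].
  by rewrite inE dart_bd // => /andP[_ /eqP<-] ->.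
by have [p <- pE] := primitive_of_bd eq_bd neq_uv; exists p; rewrite ?inE ?pE.
Qed.

Lemma dart_neq u v p : dart p = (u, v) -> u != v.
Proof. by case=> <- <-; rewrite eq_sym tgt_neq_src. Qed.

(** Two pairs can only close a directed cycle of length two. Comparing darts rather than edges
    treats this together with the two directions of a single edge. *)
Definition clash p q := (src p == src q) || (dart q == dart (flip p)).

Lemma clash_flip p : clash p (flip p).
Proof. by rewrite /clash eqxx orbT. Qed.

Lemma connected_ind (cG : mg_connected G) (A : pred (vertex G)) u v :
  (forall p, A (src p) -> A (tgt p)) -> A u -> A v.
Proof.
move=> A_tgt; have /connectP[s + ->] := cG.2 u v.
elim: s u => //= w s IHs u /andP[/existsP[e /eqP eq_bd] path_s] Au.
apply: IHs path_s _; have [p _ [sp <-]] := primitive_of_bd eq_bd (bd_neq eq_bd).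
by apply: A_tgt; rewrite sp.
Qed.

(** If no pair left [v], the set of [v] alone would be closed under adjacency, so [v] would be the
    only vertex. *)
Lemma src_exists (cG : mg_connected G) (V1 : 1 < #|vertex G|) v :
  exists p, src p = v.
Proof.
case: (pickP [pred p | src p == v]) => [p /eqP|no_p]; first by exists p.
have: [forall u, u == v].
  apply/forallP=> u; apply: (@connected_ind cG (pred1 v) v u) => [p /= sp|].
    by have := no_p p; rewrite /= sp.
  by rewrite /= eqxx.
move/forallP=> all_v; have: #|vertex G| <= 1; last by rewrite leqNgt V1.
by apply/fintype_le1P => x y; rewrite (eqP (all_v x)); apply/eqP.
Qed.

(* A third vertex can be reached only through a dart leaving an end of [p]
   and avoiding the other one. *)
Lemma third_vertex (cG : mg_connected G) (V2 : 2 < #|vertex G|) p :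
  exists2 q, src q = src p \/ src q = tgt p & tgt q \notin [set src p; tgt p].
Proof.
pose A : {set vertex G} := [set src p; tgt p].
case: (pickP [pred q | (src q \in A) && (tgt q \notin A)]) => [q|noq].
  rewrite /= => /andP[src_q tgt_q]; exists q => //.
  by move: src_q; rewrite !inE => /orP[]/eqP; [left | right].
have allA v : v \in A.
  apply: (@connected_ind cG (fun v => v \in A) (src p)); last exact: set21.
  by move=> q Aq; have := noq q; rewrite /= Aq => /negbFE.
have: #|vertex G| <= #|A| by apply/subset_leq_card/subsetP.
by rewrite leqNgt cards2; case: eqP => _; rewrite ?V2 // ltnW.
Qed.

Lemma clash_dart p q r : dart p = dart q -> clash p r = clash q r.
Proof. by move=> eq_d; rewrite /clash (dart_flipP eq_d); case: eq_d => ->. Qed.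

Lemma clashC : symmetric clash.
Proof.
move=> p q; rewrite /clash eq_sym !dart_flip /dart !xpair_eqE; congr orb.
by rewrite andbC (eq_sym (tgt q)) (eq_sym (src q)).
Qed.

(** Pairs with a common source are compared through [flip p]. Opposite pairs are told apart by a
    dart leading to a third vertex, which clashes only with the one whose source it shares. *)
Lemma dart_of_clash (cG : mg_connected G) (V2 : 2 < #|vertex G|) p q :
  (forall r, clash p r = clash q r) -> dart p = dart q.
Proof.
move=> eq_c; have /orP[/eqP eq_s|/eqP eq_d] : clash p q.
- by rewrite eq_c /clash eqxx.
- have := eq_c (flip p); rewrite clash_flip => /esym/orP[/eqP|/eqP].
    by rewrite src_flip -eq_s => /eqP; rewrite eq_sym (negPf (tgt_neq_src p)).
  by move/dart_flipP; rewrite !flipK.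
have [r src_r] := third_vertex cG V2 p.
rewrite !inE => /norP[/negPf tr1 /negPf tr2].
have := eq_c r; rewrite (clash_dart r eq_d) /clash flipK src_flip dart_flip.
rewrite !xpair_eqE tr1 tr2 !andbF !orbF; have /negPf neq_p := tgt_neq_src p.
by case: src_r => ->; rewrite eqxx ?neq_p // eq_sym neq_p.
Qed.

(** With [clash_le2], this lets the clash relation detect whether there are more than two vertices.
    The witnesses are two consecutive darts that do not return to their start. *)
Lemma noclash_exists (cG : mg_connected G) (V2 : 2 < #|vertex G|) :
  exists p q, ~~ clash p q.
Proof.
have /card_gt0P[v _] : 0 < #|vertex G| by apply: leq_trans V2.
have [p0 _] := src_exists cG (ltnW V2) v.
suff [p [q [sq tq]]] : exists p q, src q = tgt p /\ tgt q <> src p.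
  exists p, q; rewrite /clash sq eq_sym (negPf (tgt_neq_src p)) dart_flip /=.
  by rewrite xpair_eqE sq eqxx; apply/eqP.
have [q sq] := third_vertex cG V2 p0; rewrite !inE => /norP[tq tq'].
case: sq => sq; last by exists p0, q; split=> //; apply/eqP.
by exists (flip p0), q; rewrite tgt_flip; split=> //; apply/eqP.
Qed.

Lemma clash_le2 : #|vertex G| <= 2 -> forall p q, clash p q.
Proof.
move=> V2 p q; rewrite /clash; case: eqP => //= neq_s.
have /setP eqT : [set src p; tgt p] = setT.
  by apply/eqP; rewrite eqEcard subsetT cardsT cards2 eq_sym tgt_neq_src.
have inT v : (v == src p) || (v == tgt p) by have := eqT v; rewrite !inE.
have sq : src q = tgt p by case/orP: (inT (src q)) => /eqP // /esym.
have tq : tgt q = src p.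
  by case/orP: (inT (tgt q)) (tgt_neq_src q) => /eqP -> //; rewrite sq eqxx.
by rewrite /dart sq tq tgt_flip.
Qed.

End Darts.

(** * Edges of the Morse complex as non-clashing pairs *)

Section MorseClash.
Variables (R : realType) (G : multigraph).
Implicit Types p q : primitive G.
Local Open Scope ring_scope.

Lemma clash_not_simplex p q :
  p != q -> clash p q -> ~ @morse_simplex R G [set p; q].
Proof.
move=> neq_pq c_pq [_ [h hM hS]].
have reg r : r \in [set p; q] -> h (inr (edg r)) <= h (inl (src r)).
  by rewrite -hS inE.
have hp := reg p (set21 p q); have hq := reg q (set22 p q).
have one_edge v e f : v \in bd e -> v \in bd f ->
    h (inr e) <= h (inl v) -> h (inr f) <= h (inl v) -> e = f.
  move=> ve vf he hf; have [/card_le1_eqP h1 _] := hM (inl v).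
  by suff [] : (inr e : cell G) = inr f by []; apply: h1; rewrite inE /= ?ve ?vf.
have one_vertex e u v : u \in bd e -> v \in bd e ->
    h (inr e) <= h (inl u) -> h (inr e) <= h (inl v) -> u = v.
  move=> ue ve hu hv; have [_ /card_le1_eqP h1] := hM (inr e).
  by suff [] : (inl u : cell G) = inl v by []; apply: h1; rewrite inE /= ?ue ?ve.
have src_bd r : src r \in bd (edg r) by rewrite bd_edg set21.
have tgt_bd r : tgt r \in bd (edg r) by rewrite bd_edg set22.
move: c_pq; rewrite /clash => /orP[/eqP eq_s|/eqP].
  case/eqP: neq_pq; apply: eq_primitive => //.
  by apply: (one_edge (src p)); rewrite // eq_s.
rewrite dart_flip => -[sq tq].
have [eq_e|neq_e] := eqVneq (edg p) (edg q).
  have /eqP[] := tgt_neq_src p; rewrite -sq.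
  by apply: (one_vertex (edg q)); rewrite // -eq_e.
(* For opposite parallel edges, [src p] also bounds [edg q] but is already paired with [edg p]. This
   and its mirror image [lt_p] make the heights drop strictly around the 2-cycle. *)
have lt_q : h (inl (src p)) < h (inr (edg q)).
  rewrite ltNge; apply: contra neq_e => hqp; apply/eqP.
  by apply: (one_edge (src p)) => //; rewrite -tq.
have lt_p : h (inl (src q)) < h (inr (edg p)).
  rewrite ltNge; apply: contra neq_e => hpq; apply/eqP.
  by apply: (one_edge (src q)) => //; rewrite sq.
have := le_lt_trans hq (lt_le_trans lt_p (le_trans hp (ltW lt_q))).
by rewrite ltxx.
Qed.

(* Heights 4 > 3 > 2 > 1 along [src p], [edg p], [src q], [edg q]: the only
   obstruction would be [q] ending at [src p]. *)
Lemma simplex_not_clash p q : ~~ clash p q -> @morse_simplex R G [set p; q].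
Proof.
(* Each pair ending at the source of the other would be a clash, so the condition holds for one of
   the two orders. *)
wlog tq : p q / tgt q != src p => [IH nc|].
  case: (eqVneq (tgt q) (src p)) => [tq|]; last by move/IH; apply.
  rewrite setUC; apply: IH; last by rewrite clashC.
  move: nc; rewrite /clash dart_flip /dart tq negb_or xpair_eqE eqxx andbT.
  by case/andP=> _; rewrite eq_sym.
rewrite /clash negb_or => /andP[/negPf neq_s _].
have bd_src r : src r \in bd (edg r) by rewrite bd_edg set21.
have neq_e : edg p == edg q = false.
  apply/eqP=> eq_e; case/eqP: tq; apply: tgtE; last by rewrite neq_s.
  by rewrite -eq_e.
(* The remaining vertices get 0, below all edges, and the remaining edges 5, above all vertices, so
   they occur in no regular pair. *)
pose h (c : cell G) : R := match c with
  | inl v => if v == src p then 4%:R else if v == src q then 2%:R else 0%:R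
  | inr e => if e == edg p then 3%:R else if e == edg q then 1%:R else 5%:R end.
have leh v e : v \in bd e ->
    (h (inr e) <= h (inl v)) = ((v, e) == val p) || ((v, e) == val q).
  move=> ve; rewrite [val p]surjective_pairing [val q]surjective_pairing.
  rewrite !xpair_eqE -!/(src _) -!/(edg _) /h.
  have [eq_v|nvp] /= := eqVneq v (src p); last first.
    have [_|nvq] /= := eqVneq v (src q); last first.
      by do ?case: ifP => _; rewrite ler_nat.
    have [->|nep] /= := eqVneq e (edg p); first by rewrite neq_e ler_nat.
    by case: eqP; rewrite ler_nat.
  rewrite eq_v neq_s; have [->|nep] /= := eqVneq e (edg p).
    by rewrite ler_nat.
  have [eq_e|_] := eqVneq e (edg q); last by rewrite ler_nat.
  by case/eqP: tq; apply: tgtE; rewrite ?neq_s // -eq_v -eq_e.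
have regP v e : v \in bd e -> h (inr e) <= h (inl v) ->
    (v, e) = val p \/ (v, e) = val q.
  by move=> /leh -> /orP[]/eqP; [left|right].
split; first by apply/set0Pn; exists p; rewrite set21.
exists h; last first.
  by apply/setP=> r; rewrite !inE leh ?(valP r).
have neq_s' : src p <> src q by apply/eqP; rewrite neq_s.
have neq_e' : edg p <> edg q by apply/eqP; rewrite neq_e.
case=> [v|e]; split; rewrite leqNgt; apply/negP => /card_gt1P[[a|a] [[b|b] []]];
  rewrite !inE //= => /andP[pa ha] /andP[pb hb] /eqP; apply;
  move: (regP _ _ pa ha) (regP _ _ pb hb) neq_s' neq_e';
  by move=> [Ea|Ea] [Eb|Eb]; rewrite /src /edg -?Ea -?Eb /=; congruence.
Qed.

Lemma clash_simplexE p q :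
  p != q -> (~~ clash p q <-> @morse_simplex R G [set p; q]).
Proof.
move=> neq_pq; split; first exact: simplex_not_clash.
by move=> S; apply/negP => /(clash_not_simplex neq_pq).
Qed.

End MorseClash.

(** * Multigraph isomorphisms from equal multiplicities *)

Lemma card_dart_flip (G : multigraph) (p : primitive G) :
  #|[pred q | dart q == dart (flip p)]| = #|[pred q | dart q == dart p]|.
Proof.
rewrite -(card_image (can_inj (@flipK G))); apply: eq_card => q; rewrite inE.
apply/imageP/eqP => [[r]|eq_d].
  by rewrite inE => /eqP eq_r ->; rewrite (dart_flipP eq_r) flipK.
by exists (flip q); rewrite ?flipK // inE; apply/eqP/dart_flipP.
Qed.

(** Dart fibres count the edges with a given boundary, so [fibre_bij] over the boundary sets
    supplies the edge bijection; a set not of size two bounds no edge on either side. *)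
Lemma iso_of_dart_card (G G' : multigraph) (fV : vertex G -> vertex G') :
  bijective fV ->
  (forall u v, #|[pred p | dart p == (u, v)]| =
               #|[pred p | dart p == (fV u, fV v)]|) ->
  mg_isomorphic G G'.
Proof.
move=> fV_bij card_fV; have fV_inj := bij_inj fV_bij.
have [gV fVK gVK] := fV_bij.
have imV (S : {set vertex G'}) : fV @: (gV @: S) = S.
  by rewrite -imset_comp (eq_imset _ gVK) imset_id.
have [|fE fE_bij bd_fE] :=
    @fibre_bij _ _ _ (fun e : edge G => fV @: bd e) (@bd G').
  move=> S; have [S2|nS2] := eqVneq #|S| 2; last first.
    rewrite !eq_card0 // => e; rewrite !inE; apply: contraNF nS2 => /eqP<-;
      by rewrite ?(card_imset _ fV_inj) card_bd.
  have : #|gV @: S| == 2 by rewrite card_imset ?S2 //; apply: can_inj gVK.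
  case/cards2P=> u [v [neq_uv eq_S]].
  rewrite -(imV S) eq_S.
  transitivity #|[pred e | bd e == [set u; v]]|.
    by apply: eq_card => e; rewrite !inE (inj_eq (imset_inj fV_inj)).
  rewrite -card_dart // card_fV card_dart ?inj_eq //.
  by apply: eq_card => e; rewrite !inE imsetU !imset_set1.
by exists fV, fE.
Qed.

(** * Bijections preserving clashes, and their behaviour under reversal *)

Definition clash_iso (G G' : multigraph) (f : primitive G -> primitive G')
    (g : primitive G' -> primitive G) : Prop :=
  [/\ cancel f g, cancel g f,
      forall p q, clash (f p) (f q) = clash p q
    & forall p q, dart (f p) = dart (f q) <-> dart p = dart q].

Lemma clash_iso_sym (G G' : multigraph) (f : primitive G -> primitive G') g :
  clash_iso f g -> clash_iso g f.
Proof.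
by case=> fK gK f_clash f_dart; split=> // p q; rewrite -?f_clash -?f_dart !gK.
Qed.

(** Only darts are compared, since [f] may permute parallel pairs freely. *)
Definition preserves_flip (G G' : multigraph)
    (f : primitive G -> primitive G') (p : primitive G) :=
  dart (f (flip p)) == dart (flip (f p)).

Section ClashIso.
Variables (G G' : multigraph) (f : primitive G -> primitive G').
Variable (g : primitive G' -> primitive G).
Hypothesis f_iso : clash_iso f g.
Implicit Types p q : primitive G.

Let fK : cancel f g. Proof. by case: f_iso. Qed.
Let gK : cancel g f. Proof. by case: f_iso. Qed.
Let f_clash p q : clash (f p) (f q) = clash p q.
Proof. by case: f_iso. Qed.
Let f_dart p q : dart (f p) = dart (f q) <-> dart p = dart q.
Proof. by case: f_iso. Qed.

Lemma card_dart_iso p :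
  #|[pred q | dart q == dart p]| = #|[pred q | dart q == dart (f p)]|.
Proof.
rewrite -(card_image (can_inj fK)); apply: eq_card => q; rewrite inE.
apply/imageP/eqP => [[r]|eq_d]; first by rewrite inE => /eqP/f_dart<- ->.
by exists (g q); rewrite ?gK // inE; apply/eqP/f_dart; rewrite gK.
Qed.

Lemma preserves_flip_flip p : preserves_flip f (flip p) = preserves_flip f p.
Proof.
rewrite /preserves_flip flipK; apply/eqP/eqP => /dart_flipP; rewrite flipK.
  by move->.
by move<-.
Qed.

Lemma preserves_flip_dart p q :
  dart p = dart q -> preserves_flip f p = preserves_flip f q.
Proof.
move=> eq_d; rewrite /preserves_flip.
have /f_dart/dart_flipP -> := eq_d.
by have /dart_flipP/f_dart -> := eq_d.
Qed.

Lemma preserves_flip_inv p : preserves_flip g (f p) = preserves_flip f p.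
Proof.
rewrite /preserves_flip fK; apply/eqP/eqP => [/f_dart|eq_d]; first by rewrite gK.
by apply/f_dart; rewrite gK.
Qed.

(** The reversal of [G'] pulled back along [f]; at a bad pair it yields the other dart with the same
    source. *)
Definition turn p := g (flip (f p)).

Lemma turnK : involutive turn.
Proof. by move=> p; rewrite /turn gK flipK fK. Qed.

Lemma turn_dart p q : dart p = dart q -> dart (turn p) = dart (turn q).
Proof.
by move=> /f_dart/dart_flipP eq_d; apply/f_dart; rewrite /turn !gK.
Qed.

Section Bad.
Variable p : primitive G.
Hypothesis bad_p : ~~ preserves_flip f p.

(** A pair clashes with its reversal, and so do their images; not being opposite, these share their
    source. *)
Lemma bad_src_flip : src (f (flip p)) = src (f p).
Proof.
have := f_clash p (flip p); rewrite clash_flip => /orP[/eqP->//|].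
by rewrite -/(preserves_flip f p) (negPf bad_p).
Qed.

Lemma bad_src_turn : src (turn p) = src p.
Proof.
have := f_clash p (turn p); rewrite /turn gK clash_flip => /esym/orP[/eqP->//|].
move=> /eqP/f_dart; rewrite gK => eq_d.
by case/eqP: bad_p.
Qed.

Lemma dart_turn_neq : dart (turn p) <> dart p.
Proof.
move=> /f_dart; rewrite gK dart_flip => -[/eqP].
by rewrite (negPf (tgt_neq_src _)).
Qed.

(* A third dart class at [src p] would be sent into the star of [f p], yet
   would have to clash with [flip (f p)]. *)
Lemma bad_deg2 q : src q = src p -> dart q = dart p \/ dart q = dart (turn p).
Proof.
move=> eq_s; have [->|nd] := eqVneq (dart q) (dart p); first by left.
have [->|nt] := eqVneq (dart q) (dart (turn p)); first by right.
have nt' : dart (f q) != dart (flip (f p)).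
  by apply: contra nt => /eqP eq_d; apply/eqP/f_dart; rewrite gK.
have /eqP eq_fs : src (f p) == src (f q).
  have : clash (f p) (f q) by rewrite f_clash /clash eq_s eqxx.
  by rewrite /clash (negPf nt') orbF.
have : clash (f (turn p)) (f q).
  by rewrite f_clash /clash bad_src_turn eq_s eqxx.
rewrite gK /clash flipK src_flip -eq_fs (negPf (tgt_neq_src _)) /=.
by move/eqP/f_dart/eqP; rewrite (negPf nd).
Qed.

Lemma bad_turn : ~~ preserves_flip f (turn p).
Proof.
apply/negP; rewrite /preserves_flip gK flipK => /eqP/f_dart.
rewrite dart_flip => -[eq_t _]; have := tgt_neq_src (turn p).
by rewrite eq_t bad_src_turn eqxx.
Qed.

Lemma card_dart_turn :
  #|[pred q | dart q == dart (turn p)]| = #|[pred q | dart q == dart p]|.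
Proof.
by rewrite (card_dart_iso (turn p)) /turn gK card_dart_flip -card_dart_iso.
Qed.

End Bad.
End ClashIso.

(** Badness passes from a pair to its reversal and, by [bad_deg2] and [bad_turn], to every pair with
    the same source, hence through the connected multigraph. *)
Lemma all_bad (G G' : multigraph) (f : primitive G -> primitive G') g p q :
    clash_iso f g -> mg_connected G ->
  ~~ preserves_flip f p -> ~~ preserves_flip f q.
Proof.
move=> f_iso cG bad_p.
pose A v := [forall r, (src r == v) ==> ~~ preserves_flip f r].
have A_src r : ~~ preserves_flip f r -> A (src r).
  move=> bad_r; apply/forallP=> t; apply/implyP=> /eqP.
  case/(bad_deg2 f_iso bad_r) => /(preserves_flip_dart f_iso) -> //.
  exact: bad_turn.
have: A (src q).
  apply: (@connected_ind G cG A (src p)) => [r /forallP/(_ r)|].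
    by rewrite eqxx /= -(preserves_flip_flip f r) => /A_src.
  exact: A_src.
by move/forallP/(_ q); rewrite eqxx.
Qed.

(** * Construction of the isomorphism *)

Lemma iso_of_all_good (G G' : multigraph) (f : primitive G -> primitive G') g :
    clash_iso f g -> mg_connected G -> mg_connected G' ->
    1 < #|vertex G| -> 1 < #|vertex G'| ->
  (forall p, preserves_flip f p) -> mg_isomorphic G G'.
Proof.
move=> f_iso cG cG' V1 V1' good_f; have [fK gK f_clash f_dart] := f_iso.
(* Clashing without being opposite means sharing the source, and opposite darts never share one; [f]
   respects both notions. *)
have src_f p q : (src (f p) == src (f q)) = (src p == src q).
  have := f_clash p q; rewrite /clash.
  have -> : (dart (f q) == dart (flip (f p))) = (dart q == dart (flip p)).
    by rewrite -(eqP (good_f p)); apply/eqP/eqP => /f_dart.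
  have [eq_d _|_] := eqVneq (dart q) (dart (flip p)); last by rewrite !orbF.
  have [-> _] : dart q = (tgt p, src p) by rewrite -dart_flip.
  have [-> _] : dart (f q) = (tgt (f p), src (f p)).
    by rewrite -dart_flip -(eqP (good_f p)); apply/f_dart.
  by rewrite ![src _ == _]eq_sym !(negPf (tgt_neq_src _)).
have [rep rep_src] := fin_all_exists (src_exists cG V1).
have [rep' rep'_src] := fin_all_exists (src_exists cG' V1').
pose fV v := src (f (rep v)).
have fV_src p : src (f p) = fV (src p) by apply/eqP; rewrite src_f rep_src.
have fV_tgt p : tgt (f p) = fV (tgt p).
  have /eqP := good_f p; rewrite dart_flip => -[<- _].
  by rewrite fV_src.
have fV_inj : injective fV.
  by move=> u v /eqP; rewrite src_f !rep_src => /eqP.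
have fV_bij : bijective fV.
  exists (fun v => src (g (rep' v))) => [v|v].
    by apply: fV_inj; rewrite -fV_src gK rep'_src.
  by rewrite -fV_src gK rep'_src.
apply: (iso_of_dart_card fV_bij) => u v.
rewrite -(card_image (can_inj fK)); apply: eq_card => q; rewrite inE.
apply/imageP/eqP => [[r]|eq_d].
  by rewrite inE => /eqP[<- <-] ->; rewrite -fV_src -fV_tgt.
exists (g q); rewrite ?gK // inE xpair_eqE.
rewrite -!(inj_eq fV_inj) -fV_src -fV_tgt gK.
by case: eq_d => -> ->; rewrite !eqxx.
Qed.

Lemma iso_of_all_bad (G G' : multigraph) (f : primitive G -> primitive G') g :
    clash_iso f g -> mg_connected G -> mg_connected G' ->
    1 < #|vertex G| -> 1 < #|vertex G'| ->
  (forall p, ~~ preserves_flip f p) -> mg_isomorphic G G'.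
Proof.
move=> f_iso cG cG' V1 V1' bad_f; have [fK gK f_clash f_dart] := f_iso.
have bad_g p : ~~ preserves_flip g p.
  by rewrite -[p]gK (preserves_flip_inv f_iso).
have g_iso := clash_iso_sym f_iso.
have flip_neq (p : primitive G) : dart (flip p) <> dart p.
  by rewrite dart_flip => -[/eqP]; rewrite (negPf (tgt_neq_src p)).
have turn_neq (p : primitive G) := @dart_turn_neq _ _ _ _ f_iso p.
have [Z [Z_dart Z_flip Z_turn]] := involution_transversal
  (@flipK G) (turnK f_iso) (@dart_flipP G) (turn_dart f_iso) flip_neq turn_neq.
have Z_inj p q : p \in Z -> q \in Z -> src p = src q -> dart p = dart q.
  move=> pZ qZ /(bad_deg2 f_iso (bad_f q))[] // /Z_dart.
  by rewrite Z_turn qZ pZ.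
(* In [G'] the other dart at a source is the image under [f] of a reversal in [G], so [Z_flip] takes
   over the part of [Z_turn]. *)
have Z_inj' p q : g p \in Z -> g q \in Z -> src p = src q -> dart p = dart q.
  move=> pZ qZ /(bad_deg2 g_iso (bad_g q))[] //.
  by rewrite -{1}[p]gK => /f_dart/Z_dart; rewrite Z_flip qZ pZ.
have [rep repP] : exists rep, forall v, (rep v \in Z) /\ src (rep v) = v.
  apply: (@fin_all_exists _ _ (fun v p => p \in Z /\ src p = v)) => v.
  have [p <-] := src_exists cG V1 v.
  have [pZ|pZ] := boolP (p \in Z); first by exists p.
  by exists (turn f g p); rewrite Z_turn pZ (bad_src_turn f_iso).
have [rep' repP'] : exists rep, forall v, (g (rep v) \in Z) /\ src (rep v) = v.
  apply: (@fin_all_exists _ _ (fun v p => g p \in Z /\ src p = v)) => v.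
  have [p <-] := src_exists cG' V1' v.
  have [pZ|pZ] := boolP (g p \in Z); first by exists p.
  by exists (turn g f p); rewrite /turn fK Z_flip pZ (bad_src_turn g_iso).
(* The two darts leaving [v] have opposite images, with different sources; [Z] chooses between them
   consistently. *)
pose fV v := src (f (rep v)).
have fV_src p : p \in Z -> src (f p) = fV (src p).
  move=> pZ; have [rZ sr] := repP (src p).
  by have /f_dart[] := Z_inj _ _ pZ rZ (esym sr).
have fV_inj : injective fV.
  move=> u v eq_f; have [[uZ <-] [vZ <-]] := (repP u, repP v).
  have /f_dart[] // : dart (f (rep u)) = dart (f (rep v)).
  by apply: Z_inj'; rewrite ?fK.
have fV_bij : bijective fV.
  have gV_K v : fV (src (g (rep' v))) = v.
    by have [vZ sv] := repP' v; rewrite -fV_src // gK.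
  by exists (fun v => src (g (rep' v))) => v; [apply: fV_inj|]; rewrite gV_K.
(* [f] reverses the orientation: [p] is sent next to the image of the dart
   following it. *)
have fV_adj p : exists q, dart q = (fV (src p), fV (tgt p)).
  wlog pZ : p / p \in Z => [IH|].
    have [/IH//|pZ] := boolP (p \in Z).
    have [|q] := IH (flip p); first by rewrite Z_flip.
    rewrite tgt_flip src_flip => eq_q; exists (flip q).
    by rewrite dart_flip; case: eq_q => -> ->.
  (* This is the dart of [Z] leaving [tgt p]; its image is the reversal of [f (flip p)], whose
     source is that of [f p]. *)
  pose q := turn f g (flip p).
  have qZ : q \in Z by rewrite Z_turn Z_flip negbK.
  have sq : src q = tgt p by rewrite (bad_src_turn f_iso).
  exists (flip (f q)); rewrite dart_flip -{}sq -!fV_src // /q /turn gK tgt_flip.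
  by rewrite (bad_src_flip f_iso).
have fV_adj' q u v : dart q = (fV u, fV v) -> exists p, dart p = (u, v).
  wlog qZ : q u v / g q \in Z => [IH|] eq_q.
    have [qZ|qZ] := boolP (g q \in Z); first exact: (IH q).
    have [||p eq_p] := IH (flip q) v u.
    - by rewrite -[q]gK -/(turn f g (g q)) Z_turn.
    - by rewrite dart_flip; case: eq_q => -> ->.
    by exists (flip p); rewrite dart_flip; case: eq_p => -> ->.
  have eq_src : src (g q) = u.
    by apply: fV_inj; rewrite -fV_src // gK; case: eq_q.
  (* One step back along the orientation: the dart of [Z] ending at [u]. *)
  pose p := flip (turn f g (g q)).
  have pZ : p \in Z by rewrite Z_flip Z_turn negbK.
  exists (flip p); rewrite dart_flip {1}/p tgt_flip (bad_src_turn f_iso) //.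
  rewrite eq_src; congr pair; apply: fV_inj; rewrite -fV_src //.
  by rewrite (bad_src_flip f_iso) // /turn !gK src_flip; case: eq_q.
(* Multiplicity spreads as badness does, to the reversal and to the other dart at the source. Being
   constant, it is matched as soon as [fV] preserves adjacency. *)
have card_const (p q : primitive G) :
    #|[pred r | dart r == dart p]| = #|[pred r | dart r == dart q]|.
  pose A v := [forall r : primitive G, (src r == v) ==>
    (#|[pred t | dart t == dart r]| == #|[pred t | dart t == dart q]|)].
  have A_src r :
      #|[pred t | dart t == dart r]| = #|[pred t | dart t == dart q]| ->
      A (src r).
    move=> eq_r; apply/forallP=> t; apply/implyP=> /eqP/(bad_deg2 f_iso (bad_f r)).
    by case=> ->; rewrite ?(card_dart_turn f_iso) ?eq_r.
  have: A (src p).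
    apply: (@connected_ind G cG A (src q)) => [r /forallP/(_ r)|].
      by rewrite eqxx /= -card_dart_flip => /eqP/A_src.
    exact: A_src.
  by move/forallP/(_ p); rewrite eqxx => /eqP.
apply: (iso_of_dart_card fV_bij) => u v.
have [p /eqP eq_p|no_p] := pickP [pred p | dart p == (u, v)].
  have [q eq_q] := fV_adj p; move: eq_q; case: (eq_p) => -> -> eq_q.
  rewrite -eq_p -eq_q -[q]gK -(card_dart_iso f_iso); exact: card_const.
rewrite !eq_card0 // => q; rewrite inE; apply/eqP => eq_q.
have [p /eqP] := fV_adj' _ _ _ eq_q.
by have := no_p p; rewrite /= => ->.
Qed.

(** * Multigraphs with at most two vertices *)

Lemma card_dart_le2 (G : multigraph) (u v : vertex G) :
  #|vertex G| <= 2 -> u != v ->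
  #|[pred p | dart p == (u, v)]|.*2 = #|primitive G|.
Proof.
move=> V2 neq_uv; rewrite -(cardC [pred p | dart p == (u, v)]) -addnn.
congr (_ + _); transitivity #|[pred p | dart p == (v, u)]|.
  by rewrite (card_dart neq_uv) setUC -card_dart // eq_sym.
have /setP eqT : [set u; v] = setT.
  by apply/eqP; rewrite eqEcard subsetT cardsT cards2 neq_uv.
apply: eq_card => p; rewrite !inE /dart !xpair_eqE.
have inT w : (w == u) || (w == v) by have := eqT w; rewrite !inE.
move: (tgt_neq_src p).
case/orP: (inT (src p)) => /eqP->; case/orP: (inT (tgt p)) => /eqP->;
  by rewrite ?eqxx // [v == u]eq_sym (negPf neq_uv).
Qed.

(** Such a connected multigraph is a point or a bundle of parallel edges: the existence of a pair
    separates the cases, and half the number of pairs is the multiplicity. *)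
Lemma iso_of_le2 (G G' : multigraph) :
  mg_connected G -> mg_connected G' ->
  #|vertex G| <= 2 -> #|vertex G'| <= 2 ->
  #|primitive G| = #|primitive G'| -> mg_isomorphic G G'.
Proof.
move=> cG cG' V2 V2' eq_prim.
have V_gt1 (H : multigraph) : mg_connected H -> #|vertex H| <= 2 ->
    (1 < #|vertex H|) = (0 < #|primitive H|).
  move=> cH H2; apply/idP/card_gt0P => [H1|[p _]]; last first.
    by apply/card_gt1P; exists (tgt p), (src p); split=> //; apply: tgt_neq_src.
  have /card_gt0P[v _] := cH.1.
  by have [p _] := src_exists cH H1 v; exists p.
have eq_V : #|vertex G| = #|vertex G'|.
  have := V_gt1 _ cG V2; rewrite eq_prim -(V_gt1 _ cG' V2').
  have := (cG.1, cG'.1).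
  by move: #|vertex G| #|vertex G'| V2 V2' => [|[|[]]] // [|[|[]]] // _ _ [].
pose fV u := enum_val (cast_ord eq_V (enum_rank u)).
have fV_inj : injective fV.
  by move=> u v /enum_val_inj/cast_ord_inj/enum_rank_inj.
have fV_bij : bijective fV by apply: inj_card_bij; rewrite ?eq_V.
apply: (iso_of_dart_card fV_bij) => u v.
have [<-|neq_uv] := eqVneq u v; last first.
  by apply: double_inj; rewrite !card_dart_le2 ?(inj_eq fV_inj).
by rewrite !eq_card0 // => p; rewrite inE; apply/eqP => /dart_neq; rewrite eqxx.
Qed.

Theorem theoremB (R : realType) (G G' : multigraph)
    (cG : mg_connected G) (cG' : mg_connected G')
    (iso : sc_isomorphic (morse_complex R G) (morse_complex R G')) :
  mg_isomorphic G G'.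
Proof.
case: iso => f [g fK gK] f_simplex.
have f_clash p q : clash (f p) (f q) = clash p q.
  have [->|neq_pq] := eqVneq p q; first by rewrite /clash !eqxx.
  apply: negb_inj; apply/idP/idP => nc.
    apply/(clash_simplexE R neq_pq)/f_simplex; rewrite imsetU !imset_set1.
    exact: simplex_not_clash.
  have: f p != f q by rewrite (can_eq fK).
  move/(clash_simplexE R) => ->.
  rewrite -!imset_set1 -imsetU; apply/f_simplex; exact: simplex_not_clash.
(* By [noclash_exists] and [clash_le2], both multigraphs fall on the same side of this bound. *)
have [V2|V2] := leqP #|vertex G| 2.
  apply: iso_of_le2 => //; last exact: bij_eq_card (Bijective fK gK).
  rewrite leqNgt; apply/negP => /(noclash_exists cG')[p [q]].
  by rewrite -[p]gK -[q]gK f_clash clash_le2.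
have V2' : 2 < #|vertex G'|.
  rewrite ltnNge; apply/negP => V2'.
  have [p [q]] := noclash_exists cG V2.
  by rewrite -f_clash clash_le2.
have f_iso : clash_iso f g.
  split=> // p q; split=> eq_d.
    apply: (dart_of_clash cG V2) => r.
    by rewrite -!f_clash; apply: clash_dart.
  apply: (dart_of_clash cG' V2') => r.
  by rewrite -[r]gK !f_clash; apply: clash_dart.
have [p bad_p|good_f] := pickP [pred p | ~~ preserves_flip f p].
  apply: (iso_of_all_bad f_iso cG cG' (ltnW V2) (ltnW V2')) => q.
  exact: (all_bad q f_iso cG bad_p).
apply: (iso_of_all_good f_iso cG cG' (ltnW V2) (ltnW V2')) => p.
exact: negbFE (good_f p).
Qed.
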